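(* Let $d\in\mathbb{N}$, $d\ge 1$, and let $\mathbf{x}=(x_1,\dots,x_d)\in\mathbb{R}^d$ be such that $\{1,x_1,\dots,x_d\}$ is linearly independent over $\mathbb{Z}$. Then $$e_n(\mathbf{x})\ \ge\ \frac{n^{d+1}}{(d-1)!\,(d+1)}\log n-O(n^{d+1}),$$ where the implied constant depends on $\mathbf{x}$ and $d$ only; that is, there is a constant $C>0$ depending only on $\mathbf{x}$ and $d$ such that for all integers $n\ge 1$, $e_n(\mathbf{x})\ge \frac{n^{d+1}}{(d-1)!\,(d+1)}\log n-C\,n^{d+1}$.
   Context: For $\ell\in\mathbb{N}$ let $\Delta^{\ell}=\{(z_1,\dots,z_\ell)\in\mathbb{C}^{\ell}: |z_i|\le 1 \text{ for all } i\}$ be the closed unit polydisk, and for $n\in\mathbb{N}$ let $\mathcal{P}_n(\ell)$ be the vector space of polynomials in $\mathbb{C}[z_1,\dots,z_\ell]$ of (total) degree at most $n$. For $D\subset\mathbb{C}^\ell$ and a polynomial $P$ put $\|P\|_D=\sup\{|P(\mathbf{z})|:\mathbf{z}\in D\}$. For $\mathbf{x}=(x_1,\dots,x_d)$ put $$K=K(\mathbf{x})=\{(e^{z},e^{x_1z},e^{x_2z},\dots,e^{x_dz}): z\in\mathbb{C},\ |z|\le 1\}\subset\mathbb{C}^{d+1},$$ $$E_n(\mathbf{x})=\sup\{\|P\|_{\Delta^{d+1}}: P\in\mathcal{P}_n(d+1),\ \|P\|_K\le 1\},\qquad e_n(\mathbf{x})=\log E_n(\mathbf{x}).$$ *)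

(* Defs.v *)
From HB Require Import structures.
From mathcomp Require Import all_boot all_order all_algebra.
From mathcomp Require Import all_classical all_reals all_analysis.
From mathcomp Require Import complex.
(* The notations of mpoly.v clash with those of MathComp-Analysis. *)
From mathcomp Require Import -(notations) mpoly.

Set Implicit Arguments.
Unset Strict Implicit.
Unset Printing Implicit Defensive.
Import Order.TTheory GRing.Theory Num.Theory.

Local Open Scope classical_set_scope.
Local Open Scope ring_scope.

(* [ComplexField.Normc.normc] is the modulus with values in [R]; the generic
   norm of [R[i]] takes its values in [R[i]]. *)
Definition cmod (R : realType) (z : R[i]) : R := ComplexField.Normc.normc z.

(* e^(a + ib) = e^a (cos b + i sin b) *)
Definition cexp (R : realType) (z : R[i]) : R[i] :=
  Complex (expR (complex.Re z) * cos (complex.Im z))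
          (expR (complex.Re z) * sin (complex.Im z)).

Definition polydisk (R : realType) (l : nat) : set ('I_l -> R[i]) :=
  [set z | forall i, cmod (z i) <= 1].
Arguments polydisk R l : clear implicits.

(* [msize p] is 1 + the total degree of p, and 0 for p = 0. *)
Definition poly_deg_le (R : realType) (l n : nat) : set (mpoly l R[i]) :=
  [set p | (msize p <= n.+1)%N].
Arguments poly_deg_le R l n : clear implicits.

Definition supnorm (R : realType) (l : nat) (D : set ('I_l -> R[i]))
    (p : mpoly l R[i]) : \bar R :=
  ereal_sup [set (cmod (meval z p))%:E | z in D].

(* The family (1, x_1, ..., x_d), with 1 at index 0. *)
Definition cons1 (R : realType) (d : nat) (x : 'I_d -> R) : 'I_d.+1 -> R :=
  fun i => if unlift ord0 i is Some j then x j else 1.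

Definition lin_indep_int (R : realType) (m : nat) (v : 'I_m -> R) : Prop :=
  forall a : 'I_m -> int,
    \sum_(i < m) (a i)%:~R * v i = 0 -> forall i, a i = 0.

Definition expcurve (R : realType) (d : nat) (x : 'I_d -> R) :
    set ('I_d.+1 -> R[i]) :=
  [set (fun i => cexp ((cons1 x i)%:C%C * z)) | z in [set z | cmod z <= 1]].

Definition En (R : realType) (d : nat) (x : 'I_d -> R) (n : nat) : \bar R :=
  ereal_sup [set supnorm (polydisk R d.+1) p | p in
    [set p | poly_deg_le R d.+1 n p /\ (supnorm (expcurve x) p <= 1)%E]].

Definition en (R : realType) (d : nat) (x : 'I_d -> R) (n : nat) : \bar R :=
  lne (En x n).

(* Main.v *)
Require Import Defs.
From HB Require Import structures.
From mathcomp Require Import all_boot all_order all_algebra.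
From mathcomp Require Import all_classical all_reals all_analysis.
From mathcomp Require Import complex ring lra.
From mathcomp Require Import -(notations) mpoly.
From mathcomp Require cyclic separable cyclotomic.
Import Order.TTheory GRing.Theory Num.Theory.
Local Open Scope ring_scope.
Set Implicit Arguments.
Unset Strict Implicit.
Unset Printing Implicit Defensive.

(** The polynomials of degree at most n in d+1 variables have
    N = 'C(d+1+n, d+1) coefficients c_t.  On the curve, the monomial with
    exponent t becomes exp(lam_t * z), where lam_t = sum_i t_i v_i for
    v = (1, x_1, ..., x_d), so the restriction of a polynomial P to the curve is
    the exponential sum f(z) = sum_t c_t exp(lam_t * z).  Asking that f vanish
    at 0 to order m = N - 1 puts m linear conditions sum_t c_t lam_t^s = 0
    (s < m) on N unknowns, hence there is a nonzero solution, which is real and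
    can be scaled to have largest coefficient 1 ([exists_vanishing_moments]).

    Such a P is very small on the curve but not on the polydisk.  On the curve,
    the first m Taylor terms of the exponentials cancel in f, and the remainder
    bound [cexp_taylor_le] leaves |f| <= N e^L L^m / m! with L = A n
    ([exp_sum_le]), A depending on x only.  On the polydisk, Cauchy's estimate
    [mcoeff_le_polydisk] shows that |P| reaches the modulus of each of its
    coefficients, in particular 1.  Thus E_n >= (N e^(An) (An)^m / m!)^-1
    ([En_ge]).

    By Stirling, the logarithm of the right-hand side is m ln(m/n) up to an
    error O(m + n + ln N).  Since m is at least n^(d+1)/(d+1)! and at most
    (2n)^(d+1), this is at least n^(d+1) d/(d+1)! ln n - O(n^(d+1))
    ([ln_En_bound_ge]), and d/(d+1)! = 1/((d-1)! (d+1)). *)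

(** * Modulus and exponential of complex numbers *)

Lemma cmodE (R : realType) (z : R[i]) : `|z| = (cmod z)%:C%C.
Proof. by []. Qed.

Lemma cmod_ge0 (R : realType) (z : R[i]) : 0 <= cmod z.
Proof. by case: z => a b; exact: sqrtr_ge0. Qed.

Lemma cmodM (R : realType) (z w : R[i]) : cmod (z * w) = cmod z * cmod w.
Proof. exact: ComplexField.Normc.normcM. Qed.

Lemma cmodX (R : realType) (z : R[i]) k : cmod (z ^+ k) = cmod z ^+ k.
Proof.
elim: k => [|k IHk]; first by rewrite !expr0 /cmod ComplexField.Normc.normc1.
by rewrite !exprS cmodM IHk.
Qed.

Lemma cmod_real (R : realType) (r : R) : cmod r%:C%C = `|r|.
Proof. by rewrite /cmod /= expr0n /= addr0 sqrtr_sqr. Qed.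

Lemma cmod_sum (R : realType) (I : finType) (F : I -> R[i]) :
  cmod (\sum_i F i) <= \sum_i cmod (F i).
Proof.
elim/big_ind2: _ => [|z a w b za wb|//].
  by rewrite /cmod ComplexField.Normc.normc0.
exact: le_trans (le_normcD _ _) (lerD za wb).
Qed.

Lemma Re_le_cmod (R : realType) (z : R[i]) : complex.Re z <= cmod z.
Proof.
apply: le_trans (ler_norm _) _.
by rewrite -lecR -cmodE normc_ge_Re.
Qed.

Lemma cmod_cexp (R : realType) (z : R[i]) : cmod (cexp z) = expR (complex.Re z).
Proof.
rewrite /cmod /cexp /= !exprMn -mulrDr cos2Dsin2 mulr1 sqrtr_sqr.
by rewrite ger0_norm ?expR_ge0.
Qed.

Lemma cexpD (R : realType) (z w : R[i]) : cexp (z + w) = cexp z * cexp w.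
Proof.
case: z w => a b [c e]; rewrite /cexp /= expRD cosD sinD.
by apply/eqP; rewrite eq_complex /=; apply/andP; split; apply/eqP; ring.
Qed.

Lemma cexp0 (R : realType) : cexp (0 : R[i]) = 1.
Proof. by rewrite /cexp /= expR0 cos0 sin0 mulr0 mulr1. Qed.

(** * Taylor remainder of the complex exponential *)

Lemma eq_is_derive (R : realType) (f g : R -> R) (t df dg : R) :
  is_derive t 1 f df -> f =1 g -> df = dg -> is_derive t 1 g dg.
Proof. by move=> + /funext <- <-. Qed.

Lemma is_derive_exp_poly (R : realType) (a : nat -> R) m (t : R) :
  is_derive t 1 (fun u => \sum_(s < m.+1) a s * u ^+ s / s`!%:R)
    (\sum_(s < m) a s.+1 * t ^+ s / s`!%:R).
Proof.
elim: m => [|m IHm].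
  refine (eq_is_derive (is_derive_cst (a 0%N) t 1) _ _) => [u|];
    last by rewrite big_ord0.
  by rewrite big_ord1 expr0 mulr1 fact0 divr1.
have dX := @is_deriveX R R id m.+1 t 1 1 (is_derive_id t 1).
have dZ := is_deriveZ (a m.+1 / (m.+1)`!%:R) dX.
refine (eq_is_derive (is_deriveD IHm dZ) _ _) => [u|].
  by rewrite big_ord_recr /= !fctE /GRing.scale /= mulrAC.
rewrite [RHS]big_ord_recr /= /GRing.scale /= mulr1 factS natrM; congr (_ + _).
by field; rewrite pnatr_eq0 -lt0n fact_gt0 addrC natr1 pnatr_eq0.
Qed.

(** The real part of v times the m-th Taylor remainder of exp at t * w.  A
    complex-valued function has no mean value theorem; its real parts after
    multiplication by constants v have one, and letting v range over all complex
    numbers recovers the modulus. *)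
Definition ray_rem (R : realType) (w v : R[i]) m (t : R) : R :=
  complex.Re (v * cexp (t%:C%C * w))
    - \sum_(s < m) complex.Re (v * w ^+ s) * t ^+ s / s`!%:R.

(** Differentiating exp(t * w) brings down a factor w, which is absorbed by v;
    this lets the order m decrease while the shape is preserved. *)
Lemma is_derive_ray_rem (R : realType) (w v : R[i]) m (t : R) :
  is_derive t 1 (ray_rem w v m.+1) (ray_rem w (v * w) m t).
Proof.
have dT := @is_derive_exp_poly R (fun s => complex.Re (v * w ^+ s)) m t.
case: v w dT => p q [a b] dT.
have dE : is_derive t 1
    (fun u => expR (u * a) * (p * cos (u * b) - q * sin (u * b)))
    (expR (t * a) * (a * (p * cos (t * b) - q * sin (t * b))
       + b * (- p * sin (t * b) - q * cos (t * b)))).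
  by apply: is_derive_eq; rewrite /GRing.scale /=; ring.
refine (eq_is_derive (is_deriveB dE dT) _ _) => [u|].
  rewrite /ray_rem /= !mul0r subr0 addr0; congr (_ - _); ring.
rewrite /ray_rem /= !mul0r subr0 addr0; congr (_ - _); first by ring.
by apply: eq_bigr => s _; rewrite exprS mulrA.
Qed.

(** By induction on m for all v at once: the difference of the two sides at
    order m.+1 vanishes at t = 0, and its derivative is the difference of the
    two sides at order m with v replaced by v * w, which is nonpositive. *)
Lemma ray_rem_le (R : realType) (w v : R[i]) m (t : R) : 0 <= t -> t <= 1 ->
  ray_rem w v m t <= cmod v * expR (cmod w) * (cmod w * t) ^+ m / m`!%:R.
Proof.
elim: m v t => [|m IHm] v t t0 t1.
  rewrite /ray_rem big_ord0 subr0 expr0 mulr1 fact0 divr1.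
  apply: le_trans (Re_le_cmod _) _; rewrite cmodM ler_wpM2l ?cmod_ge0 //.
  rewrite cmod_cexp ler_expR; apply: le_trans (Re_le_cmod _) _.
  by rewrite cmodM cmod_real ger0_norm // ler_piMl ?cmod_ge0.
pose K := cmod v * expR (cmod w) * cmod w ^+ m.+1.
(* The bound K t^(m+1)/(m+1)! is written as a truncated series with a single
   nonzero coefficient, so that [is_derive_exp_poly] differentiates it. *)
pose b s := K * (s == m.+1)%:R.
pose g u := ray_rem w v m.+1 u - \sum_(s < m.+2) b s * u ^+ s / s`!%:R.
have gE u : g u = ray_rem w v m.+1 u - K * u ^+ m.+1 / (m.+1)`!%:R.
  rewrite /g big_ord_recr /= big1 ?add0r /b ?eqxx ?mulr1 // => s _.
  by rewrite ltn_eqF ?ltn_ord // mulr0 !mul0r.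
have dg (u : R) : is_derive u 1 g
    (ray_rem w (v * w) m u - \sum_(s < m.+1) b s.+1 * u ^+ s / s`!%:R).
  exact: is_deriveB (is_derive_ray_rem _ _ _ _) (is_derive_exp_poly _ _ _).
have dgE (u : R) :
    g^`()%classic u = ray_rem w (v * w) m u - K * u ^+ m / m`!%:R.
  rewrite derive1E; have -> := @derive_val _ _ _ _ _ _ _ (dg u).
  rewrite big_ord_recr /= big1 ?add0r /b ?eqxx ?mulr1 // => s _.
  by rewrite eqSS ltn_eqF ?ltn_ord // mulr0 !mul0r.
have dg_ex (u : R) : derivable g u 1 by apply: ex_derive.
have : g t <= g 0.
  apply: (@ler0_derive1_nincr _ g 0 1) => // [u /[!in_itv]/= /andP[u0 u1]|].
    rewrite dgE subr_le0; apply: le_trans (IHm _ _ (ltW u0) (ltW u1)) _.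
    by rewrite cmodM /K exprMn exprS le_eqVlt; apply/orP; left; apply/eqP; ring.
  by apply: derivable_within_continuous.
have w0 : (0 : R)%:C%C * w = 0 by exact: mul0r.
rewrite !gE {2}/ray_rem w0 cexp0 mulr1 big_ord_recl expr0 expr0n /=.
rewrite big1 => [|s _]; last by rewrite expr0n mulr0 mul0r.
rewrite !mulr1 divr1 addr0 subrr expr0n mulr0 mul0r subrr subr_le0.
by rewrite exprMn mulrA.
Qed.

(** The choice v = conj(rem) turns Re(v * rem) into |rem|^2, and one factor
    |rem| then cancels. *)
Lemma cexp_taylor_le (R : realType) m (w : R[i]) :
  cmod (cexp w - \sum_(s < m) w ^+ s / s`!%:R)
    <= expR (cmod w) * cmod w ^+ m / m`!%:R.
Proof.
set z := cexp w - _.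
have [->|z0] := eqVneq z 0.
  rewrite /cmod ComplexField.Normc.normc0 divr_ge0 ?ler0n //.
  rewrite mulr_ge0 ?expR_ge0 //.
  by rewrite exprn_ge0 ?cmod_ge0.
have cz : cmod z^*%C = cmod z.
  by apply: (@complexI R); rewrite -!cmodE normcJ.
have zz : complex.Re (z^*%C * z) = cmod z ^+ 2.
  have := sqr_normc z; rewrite cmodE -rmorphXn mulrC => <- //.
have zgt0 : 0 < cmod z.
  rewrite lt_neqAle cmod_ge0 andbT eq_sym.
  by apply: contra z0 => /eqP/ComplexField.Normc.eq0_normc ->.
have := @ray_rem_le _ w z^*%C m 1 ler01 (lexx _).
have -> : ray_rem w z^*%C m 1 = cmod z ^+ 2.
  have ReB (p q : R[i]) : complex.Re (p - q) = complex.Re p - complex.Re q.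
    by case: p q => ? ? [].
  have ReD : {morph @complex.Re R : p q / p + q} by case=> ? ? [].
  rewrite -zz {2}/z mulrBr ReB /ray_rem mul1r; congr (_ - _).
  rewrite mulr_sumr (big_morph _ ReD (erefl _)); apply: eq_bigr => s _.
  rewrite expr1n mulr1 mulrA.
  case: (z^*%C * w ^+ s) => p q.
  have -> : (s`!%:R : R[i])^-1 = (s`!%:R^-1)%:C%C.
    by rewrite fmorphV /= rmorph_nat.
  by rewrite /= mulr0 subr0.
by rewrite cz expr2 mulr1 -!mulrA ler_pM2l.
Qed.

(** * Cauchy estimate for the coefficients of a polynomial *)

(** 'X^n - 1 splits and is separable, so its n roots form a cyclic group. *)
Lemma prim_root_exists (F : numClosedFieldType) n :
  (0 < n)%N -> exists w : F, n.-primitive_root w.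
Proof.
move=> n_gt0; have [r Dp] := closed_field_poly_normal ('X^n - 1 : {poly F}).
rewrite (monicP _) ?monicXnsubC // scale1r in Dp.
have rn1 : all n.-unity_root r by apply/allP=> z; rewrite -root_prod_XsubC -Dp.
have sz_r : (n < (size r).+1)%N.
  by rewrite -(size_prod_XsubC r id) -Dp size_XnsubC.
have [|z _ pz] := hasP (cyclic.has_prim_root n_gt0 rn1 _ sz_r);
  last by exists z.
rewrite -separable.separable_prod_XsubC -Dp cyclotomic.separable_Xn_sub_1 //.
by rewrite pnatr_eq0 -lt0n.
Qed.

(** Orthogonality of the characters of Z/M; M - b stands for the exponent
    - b, so that all exponents are natural numbers. *)
Lemma sum_prim_root (F : fieldType) M (w : F) a b : M.-primitive_root w ->
  (a < M)%N -> (b < M)%N ->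
  \sum_(j < M) (w ^+ (a + (M - b))) ^+ j = if a == b then M%:R else 0.
Proof.
move=> pw aM bM; have [->|ab] := eqVneq a b.
  rewrite subnKC ?(ltnW bM) // (prim_expr_order pw).
  under eq_bigr do rewrite expr1n.
  by rewrite sumr_const card_ord.
(* The exponent lies strictly between 0 and 2M, so M divides it only if it
   equals M, that is, only if a = b. *)
have w1 : w ^+ (a + (M - b)) != 1.
  rewrite -(prim_order_dvd pw); apply/negP => /dvdnP[q].
  case: q => [|[|q]]; rewrite ?mul0n ?mul1n ?mulSn.
  - by move/eqP; rewrite addn_eq0 subn_eq0 leqNgt bM andbF.
  - move=> e; move/eqP: ab; apply; apply/eqP.
    by rewrite -(eqn_add2r (M - b)) e subnKC // ltnW.
  move=> e; have : (a + (M - b) < M + M)%N by rewrite -addSn leq_add ?leq_subr.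
  by rewrite e addnA -[X in (_ < X)%N]addn0 ltn_add2l.
apply/eqP; move: w1; rewrite -subr_eq0 => /mulfI/inj_eq <-.
by rewrite mulr0 -subrX1 exprAC (prim_expr_order pw) expr1n subrr.
Qed.

Lemma cmod_prim_root (R : realType) M (w : R[i]) :
  M.-primitive_root w -> cmod w = 1.
Proof.
move=> pw; apply/eqP; rewrite -(@eqrXn2 _ M) ?cmod_ge0 ?(prim_order_gt0 pw) //.
rewrite -cmodX (prim_expr_order pw) expr1n.
by rewrite /cmod ComplexField.Normc.normc1.
Qed.

(** Discrete Fourier inversion on the grid of M-th roots of unity: a sum over
    the grid replaces the Cauchy integral over the torus, and is exact because
    M exceeds all the degrees. *)
Lemma mcoeff_average (F : fieldType) l (p : mpoly l F) (m : multinom l) M w :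
  M.-primitive_root w -> (msize p <= M)%N -> (mdeg m < M)%N ->
  \sum_(j : {ffun 'I_l -> 'I_M})
      (\prod_i (w ^+ j i) ^+ (M - m i)) * meval (fun i => w ^+ j i) p
    = M%:R ^+ l * mcoeff m p.
Proof.
move=> pw pM mM.
have ltM (k : multinom l) i : (mdeg k < M)%N -> (k i < M)%N.
  by apply: leq_ltn_trans; rewrite mdegE (bigD1 i) //= leq_addr.
have orth k : (mdeg k < M)%N ->
    \sum_(j : {ffun 'I_l -> 'I_M}) \prod_i (w ^+ j i) ^+ (k i + (M - m i))
      = if k == m then M%:R ^+ l else 0.
  move=> kM.
  rewrite -(bigA_distr_bigA
    (fun i (a : 'I_M) => (w ^+ a) ^+ (k i + (M - m i)))).
  have sumE i : \sum_(a < M) (w ^+ a) ^+ (k i + (M - m i)) =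
      if k i == m i then M%:R else 0.
    rewrite -(sum_prim_root pw (ltM _ _ kM) (ltM _ _ mM)).
    by apply: eq_bigr => a _; rewrite exprAC.
  have [km|km] := eqVneq k m.
    under eq_bigr => i _ do rewrite sumE km eqxx.
    by rewrite prodr_const card_ord.
  have [i /negbTE kmi] : exists i, k i != m i.
    apply/existsP; rewrite -negb_forall; apply: contra km => /forallP h.
    by apply/eqP/mnmP => i; apply/eqP.
  by rewrite (bigD1 i) //= sumE kmi mul0r.
have termE (j : {ffun 'I_l -> 'I_M}) :
    (\prod_i (w ^+ j i) ^+ (M - m i)) * meval (fun i => w ^+ j i) p =
    \sum_(k <- msupp p) mcoeff k p * \prod_i (w ^+ j i) ^+ (k i + (M - m i)).
  rewrite mevalE mulr_sumr; apply: eq_bigr => k _; rewrite mulrCA -big_split /=.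
  by congr (_ * _); apply: eq_bigr => i _; rewrite mulrC -exprD.
rewrite (eq_bigr _ (fun j _ => termE j)).
rewrite exchange_big /=.
rewrite (eq_big_seq
  (fun k => if k == m then M%:R ^+ l * mcoeff m p else 0)).
  have [mp|mp] := boolP (m \in msupp p).
    rewrite (bigD1_seq m) ?msupp_uniq //= eqxx.
    by rewrite big1 ?addr0 // => k /negbTE ->.
  rewrite memN_msupp_eq0 // mulr0 big_seq big1 // => k kp.
  by case: eqP => // km; rewrite -km kp in mp.
move=> k kp; rewrite -mulr_sumr.
rewrite orth; last exact: leq_trans (msize_mdeg_lt kp) pM.
by case: eqP => [->|_]; rewrite ?mulr0 1?mulrC.
Qed.

(** Cauchy's estimate: a coefficient is an average of values of p at points of
    the torus, each multiplied by a number of modulus 1, so one of these values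
    is at least as large. *)
Lemma mcoeff_le_polydisk (R : realType) l (p : mpoly l R[i]) (m : multinom l) :
  exists2 z, polydisk R l z & cmod (mcoeff m p) <= cmod (meval z p).
Proof.
pose M := maxn (msize p) (mdeg m).+1.
have M0 : (0 < M)%N by rewrite leq_max orbT.
have [w pw] := prim_root_exists R[i] M0.
pose z (j : {ffun 'I_l -> 'I_M}) := fun i => w ^+ j i.
have cz j i : cmod (z j i) = 1 by rewrite cmodX (cmod_prim_root pw) expr1n.
apply: contrapT => nz.
have lt j : cmod (meval (z j) p) < cmod (mcoeff m p).
  rewrite ltNge; apply/negP => h; apply: nz; exists (z j) => // i.
  by rewrite cz.
have := congr1 (@cmod R)
  (@mcoeff_average _ l p m M w pw (leq_maxl _ _) (leq_maxr _ _)).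
apply/eqP; rewrite lt_eqF // cmodM cmodX.
apply: le_lt_trans (cmod_sum _) _.
have -> : cmod (M%:R : R[i]) = M%:R.
  by rewrite -(rmorph_nat (real_complex R)) cmod_real ger0_norm.
have -> : M%:R ^+ l * cmod (mcoeff m p) =
    \sum_(j : {ffun 'I_l -> 'I_M}) cmod (mcoeff m p).
  by rewrite sumr_const card_ffun !card_ord -[RHS]mulr_natl natrX.
apply: ltr_sum => [|j _].
  by apply/hasP; exists [ffun=> Ordinal M0]; rewrite // mem_index_enum.
rewrite cmodM (_ : cmod _ = 1) ?mul1r ?lt //.
elim/big_ind: _ => [|u v cu cv|i _]; last by rewrite cmodX cz expr1n.
  exact: ComplexField.Normc.normc1.
by rewrite cmodM cu cv mulr1.
Qed.

(** * Small exponential sums *)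

(** There are fewer linear equations than unknowns, so the system has a nonzero
    solution; dividing it by its largest entry gives c. *)
Lemma exists_vanishing_moments (R : realFieldType) (I : finType) (lam : I -> R)
    m : (m < #|I|)%N ->
  exists (c : I -> R) k0, [/\ c k0 = 1, forall k, `|c k| <= 1 &
    forall s, (s < m)%N -> \sum_k c k * lam k ^+ s = 0].
Proof.
move=> mI.
pose A : 'M[R]_(#|I|, m) := \matrix_(k, s) lam (enum_val k) ^+ s.
have [i ki] : exists i, row i (kermx A) != 0.
  apply/existsP; rewrite -[X in is_true X]negbK negb_exists.
  apply/negP => /forallP k0.
  have : (\rank (kermx A) > 0)%N.
    by rewrite mxrank_ker subn_gt0 (leq_ltn_trans (rank_leq_col _) mI).
  rewrite lt0n mxrank_eq0 => /eqP; apply; apply/row_matrixP => j.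
  by rewrite row0; apply/eqP; rewrite -[_ == _]negbK.
pose u k := kermx A i (enum_rank k).
have [k1 uk1] : exists k, u k != 0.
  have [j kij] := rV0Pn _ ki; exists (enum_val j).
  by rewrite /u enum_valK; rewrite mxE in kij.
pose k0 := [arg max_(k > k1) `|u k|]%O.
have uk0 k : `|u k| <= `|u k0| by rewrite /k0; case: arg_maxP => // j _; apply.
have u0 : 0 < `|u k0| by apply: lt_le_trans (uk0 k1); rewrite normr_gt0.
exists (fun k => u k / u k0), k0; split => [|k|s sm].
- by rewrite divff // -normr_gt0.
- by rewrite normrM normfV ler_pdivrMr // mul1r.
have /matrixP/(_ i (Ordinal sm)) := mulmx_ker A; rewrite !mxE => kA.
rewrite -[RHS](mul0r (u k0)^-1) -[X in _ = X / _]kA mulr_suml.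
rewrite (reindex _ (onW_bij _ (@enum_val_bij I))) /=.
by apply: eq_bigr => j _; rewrite /u enum_valK [A _ _]mxE mulrAC.
Qed.

(** The vanishing moments make the Taylor polynomials of order m of the
    exponentials cancel in the sum, so only the remainders contribute. *)
Lemma exp_sum_le (R : realType) (I : finType) (lam c : I -> R) (L : R) m :
  (forall k, `|c k| <= 1) -> (forall k, `|lam k| <= L) ->
  (forall s, (s < m)%N -> \sum_k c k * lam k ^+ s = 0) ->
  forall z : R[i], cmod z <= 1 ->
  cmod (\sum_k (c k)%:C%C * cexp ((lam k)%:C%C * z))
    <= #|I|%:R * (expR L * L ^+ m / m`!%:R).
Proof.
move=> c1 lamL c0 z z1.
have taylor0 : \sum_k (c k)%:C%C *
    (\sum_(s < m) ((lam k)%:C%C * z) ^+ s / s`!%:R) = 0 :> R[i].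
  under eq_bigr do rewrite mulr_sumr.
  rewrite exchange_big big1 //= => s _.
  transitivity ((\sum_k c k * lam k ^+ s)%:C%C * (z ^+ s / s`!%:R)); last first.
    by rewrite c0 // mul0r.
  rewrite rmorph_sum mulr_suml; apply: eq_bigr => k _.
  by rewrite rmorphM rmorphXn exprMn; ring.
rewrite -[X in cmod X]subr0 -[X in _ - X]taylor0 -sumrB.
apply: le_trans (cmod_sum _) _.
rewrite mulr_natl -sumr_const; apply: ler_sum => k _.
rewrite -mulrBr cmodM cmod_real.
set w := (lam k)%:C%C * z.
have wL : cmod w <= L.
  rewrite cmodM cmod_real -[L]mulr1; apply: ler_pM => //; exact: cmod_ge0.
apply: le_trans (_ : 1 * (expR (cmod w) * cmod w ^+ m / m`!%:R) <= _).
  by apply: ler_pM (c1 k) (cexp_taylor_le _ _) => //; exact: cmod_ge0.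
rewrite mul1r ler_wpM2r ?invr_ge0 ?ler0n //.
rewrite ler_pM ?expR_ge0 ?exprn_ge0 ?cmod_ge0 //.
  by rewrite ler_expR.
by rewrite lerXn2r // nnegrE ?cmod_ge0 // (le_trans (cmod_ge0 w)).
Qed.

(** * The extremal polynomial *)

(** Exponents of total degree at most n, with every entry bounded by n a priori:
    this is the finite type counted by [card_partial_ord_partitions]. *)
Definition low_mon l n := {t : l.-tuple 'I_n.+1 | (\sum_(i <- t) i <= n)%N}.

Lemma card_low_mon l n : #|{: low_mon l n}| = 'C(l + n, l).
Proof.
rewrite card_sig -card_partial_ord_partitions.
by apply: eq_card => t; rewrite !inE.
Qed.

Definition low_mon_multinom l n (t : low_mon l n) : multinom l :=
  Multinom (map_tuple val (sval t)).

Lemma low_mon_multinomE l n (t : low_mon l n) i :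
  low_mon_multinom t i = tnth (sval t) i.
Proof. by rewrite multinomE tnth_map. Qed.

Lemma low_mon_multinom_inj l n : injective (@low_mon_multinom l n).
Proof.
move=> t u tu; apply/val_inj/eq_from_tnth => i; apply: val_inj.
by rewrite /= -!low_mon_multinomE tu.
Qed.

Lemma mdeg_low_mon l n (t : low_mon l n) : (mdeg (low_mon_multinom t) <= n)%N.
Proof.
rewrite mdegE; under eq_bigr do rewrite low_mon_multinomE.
by rewrite -(big_tuple _ _ _ xpredT (fun i : 'I_n.+1 => i : nat)) (svalP t).
Qed.

Lemma cexp_sum (R : realType) (I : finType) (F : I -> R[i]) :
  cexp (\sum_i F i) = \prod_i cexp (F i).
Proof. exact: (big_morph _ (@cexpD R) (cexp0 R)). Qed.

Lemma cexpMn (R : realType) (z : R[i]) k : cexp (k%:R * z) = cexp z ^+ k.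
Proof.
elim: k => [|k IHk]; first by rewrite mul0r cexp0.
by rewrite -natr1 mulrDl mul1r cexpD IHk exprSr.
Qed.

(** The witness is the polynomial whose coefficients are given by
    [exists_vanishing_moments] for the frequencies lam, divided by its bound B
    on the curve; its coefficient at t0 is then 1 / B. *)
Lemma En_ge (R : realType) d (x : 'I_d -> R) n m (L : R) :
  (m < 'C(d.+1 + n, d.+1))%N -> 0 < L -> n%:R * \sum_i `|cons1 x i| <= L ->
  ((('C(d.+1 + n, d.+1))%:R * (expR L * L ^+ m / m`!%:R))^-1%:E <= En x n)%E.
Proof.
move=> mN L0 Lge; pose T := low_mon d.+1 n.
pose lam (t : T) := \sum_i (low_mon_multinom t i)%:R * cons1 x i.
have lamL t : `|lam t| <= L.
  apply: le_trans Lge; apply: le_trans (ler_norm_sum _ _ _) _.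
  rewrite mulr_sumr; apply: ler_sum => i _.
  rewrite normrM normr_nat ler_wpM2r // ler_nat.
  by rewrite low_mon_multinomE -ltnS ltn_ord.
have [c [t0 [ct0 c1 c0]]] : exists (c : T -> R) t0, [/\ c t0 = 1,
    forall t, `|c t| <= 1 & forall s, (s < m)%N -> \sum_t c t * lam t ^+ s = 0].
  by apply: exists_vanishing_moments; rewrite card_low_mon.
pose B := ('C(d.+1 + n, d.+1))%:R * (expR L * L ^+ m / m`!%:R).
have B0 : 0 < B.
  rewrite !mulr_gt0 ?expR_gt0 ?exprn_gt0 ?invr_gt0 // ltr0n ?fact_gt0 //.
  exact: leq_ltn_trans mN.
pose P := B^-1%:C%C *: \sum_t (c t)%:C%C *: mpolyX R[i] (low_mon_multinom t).
have mevalP z : meval z P =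
    B^-1%:C%C * \sum_t (c t)%:C%C * \prod_i z i ^+ low_mon_multinom t i.
  rewrite mevalZ raddf_sum; congr (_ * _); apply: eq_bigr => t _.
  by rewrite /= mevalZ mevalX.
have P_deg : poly_deg_le R d.+1 n P.
  apply: leq_trans (msizeZ_le _ _) _; apply: leq_trans (msize_sum _ _ _) _.
  apply/bigmax_leqP => t _; apply: leq_trans (msizeZ_le _ _) _.
  by rewrite msizeX ltnS mdeg_low_mon.
have P_coef : mcoeff (low_mon_multinom t0) P = B^-1%:C%C.
  rewrite mcoeffZ raddf_sum (bigD1 t0) //= mcoeffZ mcoeffX eqxx ct0 big1.
    by rewrite addr0 !mulr1.
  move=> t /negbTE tt0; rewrite mcoeffZ mcoeffX.
  by rewrite (inj_eq (@low_mon_multinom_inj _ _)) tt0 mulr0.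
have [z Dz] := mcoeff_le_polydisk P (low_mon_multinom t0).
rewrite P_coef cmod_real gtr0_norm ?invr_gt0 // -lee_fin => /le_trans; apply.
apply: (@le_trans _ _ (supnorm (polydisk R d.+1) P)).
  by apply: ereal_sup_ubound; exists z.
apply: ereal_sup_ubound; exists P => //; split=> //.
apply: ge_ereal_sup => _ [_ [y y1 <-] <-]; rewrite lee_fin mevalP.
have prodE t : \prod_i cexp ((cons1 x i)%:C%C * y) ^+ low_mon_multinom t i =
    cexp ((lam t)%:C%C * y).
  rewrite rmorph_sum mulr_suml cexp_sum; apply: eq_bigr => i _.
  by rewrite -cexpMn rmorphM rmorph_nat mulrA.
under eq_bigr do rewrite prodE.
rewrite cmodM cmod_real gtr0_norm ?invr_gt0 // ler_pdivrMl // mulr1.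
by have := exp_sum_le c1 lamL c0 y1; rewrite card_low_mon.
Qed.

(** * Asymptotics *)

Lemma bin_addl_le_exp l n : ('C(l + n, l) <= n.+1 ^ l)%N.
Proof.
rewrite -card_low_mon card_sig (leq_trans (max_card _)) //.
by rewrite card_tuple card_ord.
Qed.

(** The product (n+1)...(n+l+1) contains both n^(l+1) and (l+1)!, so that the
    bound survives the loss of 1 in N - 1. *)
Lemma exp_le_pred_bin_fact l n :
  (n ^ l.+1 <= ('C(l.+1 + n, l.+1)).-1 * (l.+1)`!)%N.
Proof.
rewrite -subn1 mulnBl mul1n bin_ffact leq_subRL.
  elim: l => [|l IHl]; first by rewrite ffactn1 expn1 add1n.
  rewrite addSn ffactSS -addSn factS expnS.
  apply: leq_trans (leq_mul (leqnn _) IHl).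
  by rewrite mulnDr leq_add // leq_mul // ?leq_addr // ?leq_addl.
by rewrite -bin_ffact leq_pmull // bin_gt0 leq_addr.
Qed.

(** The weak Stirling bound (m/e)^m <= m!, read off the m-th term of the series
    of e^m. *)
Lemma ln_fact_ge (R : realType) m : (0 < m)%N ->
  m%:R * ln m%:R - m%:R <= ln m`!%:R :> R.
Proof.
move=> m0; have := expR_ge1Dxn m.-1 (ler0n R m).
rewrite prednK // => h.
have fgt0 : 0 < m`!%:R :> R by rewrite ltr0n fact_gt0.
have : m%:R ^+ m <= expR m%:R * m`!%:R :> R.
  by rewrite -ler_pdivrMr //; apply: le_trans h; rewrite lerDr ler01.
rewrite -ler_ln ?posrE ?mulr_gt0 ?expR_gt0 ?exprn_gt0 ?ltr0n ?fact_gt0 //.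
rewrite lnXn ?ltr0n // lnM ?posrE ?expR_gt0 // expRK -[ln _ *+ m]mulr_natl.
by rewrite lerBlDl.
Qed.

(** With m = N - 1, the quantity to bound is at least m (ln m - ln n) up to
    O(m + n + ln N); n^(d+1) <= m (d+1)! gives ln m - ln n >= d ln n -
    ln (d+1)!, and the errors are absorbed by m <= N <= (2n)^(d+1). *)
Lemma ln_En_bound_ge (R : realType) d n (A : R) :
  (0 < n)%N -> 1 <= A ->
  let N := 'C(d.+1 + n, d.+1) in let q := ((d.+1)`!)%:R : R in
  n%:R ^+ d.+1 * (d%:R / q) * ln n%:R
    - (2 ^+ d.+1 * (2 + ln q + ln A) + A) * n%:R ^+ d.+1
  <= ln (N%:R * (expR (A * n%:R) * (A * n%:R) ^+ N.-1 / (N.-1)`!%:R))^-1.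
Proof.
move=> n0 A1 /=; set N := binomial _ _; set q : R := (_`!)%:R; set m := N.-1.
pose X : R := n%:R ^+ d.+1.
have nR : 1 <= n%:R :> R by rewrite ler1n.
have n_gt0 : 0 < n%:R :> R by rewrite ltr0n.
have X1 : 1 <= X by rewrite exprn_ege1.
have X0 : 0 < X by apply: lt_le_trans X1.
have A0 : 0 < A by apply: lt_le_trans A1.
have q1 : 1 <= q by rewrite ler1n fact_gt0.
have q0 : 0 < q by apply: lt_le_trans q1.
have N0 : (0 < N)%N by rewrite bin_gt0 leq_addr.
have XmN : X <= m%:R * q.
  by rewrite /X -natrX -natrM ler_nat; exact: exp_le_pred_bin_fact.
have m0 : (0 < m)%N.
  by rewrite lt0n; apply/eqP => m0; move: XmN; rewrite m0 mul0r leNgt X0.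
have mR : 0 < m%:R :> R by rewrite ltr0n.
have NX : N%:R <= 2 ^+ d.+1 * X.
  apply: (@le_trans _ _ ((n.+1 ^ d.+1)%:R)).
    by rewrite ler_nat bin_addl_le_exp.
  rewrite natrX -exprMn lerXn2r ?nnegrE ?mulr_ge0 // -natrM ler_nat.
  by rewrite mul2n -addnn -addn1 leq_add2l.
have mX : m%:R <= 2 ^+ d.+1 * X by apply: le_trans NX; rewrite ler_nat leq_pred.
have lnq : 0 <= ln q by rewrite ln_ge0.
have lnA : 0 <= ln A by rewrite ln_ge0.
have lnn : 0 <= ln n%:R :> R by rewrite ln_ge0.
have ln_m : d.+1%:R * ln n%:R <= ln m%:R + ln q.
  rewrite -lnM ?posrE // mulr_natl -lnXn //.
  by rewrite ler_ln ?posrE ?mulr_gt0 ?exprn_gt0.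
have ln_N : ln N%:R <= N%:R :> R by rewrite ltW // ln_sublinear // ltr0n.
have nX : n%:R <= X by rewrite -[leLHS]expr1 ler_weXn2l.
have fact_ge := ln_fact_ge R m0.
have An0 : 0 < A * n%:R by rewrite mulr_gt0.
rewrite lnV ?posrE ?mulr_gt0 ?invr_gt0 ?expR_gt0 ?exprn_gt0 ?ltr0n ?fact_gt0 //.
rewrite !lnM ?lnV ?posrE ?mulr_gt0 ?invr_gt0 ?expR_gt0 ?exprn_gt0 //;
  rewrite ?ltr0n ?fact_gt0 //.
rewrite expRK lnXn // lnM ?posrE // -[(ln A + _) *+ m]mulr_natl.
have main : X / q * (d%:R * ln n%:R) <= m%:R * (d%:R * ln n%:R).
  by rewrite ler_wpM2r ?mulr_ge0 // ler_pdivrMr.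
have m_ln_m : m%:R * (d.+1%:R * ln n%:R) <= m%:R * (ln m%:R + ln q).
  by rewrite ler_pM2l.
have err : m%:R * (1 + ln q + ln A) <= 2 ^+ d.+1 * X * (1 + ln q + ln A).
  by rewrite ler_wpM2r // !addr_ge0.
have AnX : A * n%:R <= A * X by rewrite ler_pM2l.
rewrite -/X.
have -> : X * (d%:R / q) * ln n%:R = X / q * (d%:R * ln n%:R) by ring.
rewrite -natr1 in m_ln_m.
lra.
Qed.

Theorem theorem1p1 (R : realType) (d : nat) (x : 'I_d -> R) :
  (1 <= d)%N ->
  lin_indep_int (cons1 x) ->
  exists C : R, 0 < C /\
    forall n : nat, (1 <= n)%N ->
      ((n%:R ^+ d.+1 / (((d.-1)`!)%:R * d.+1%:R) * ln n%:R
          - C * n%:R ^+ d.+1)%:E <= en x n)%E.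
Proof.
move=> d1 _; pose A := 1 + \sum_i `|cons1 x i|.
have A1 : 1 <= A by rewrite lerDl sumr_ge0.
have A0 : 0 < A by apply: lt_le_trans A1.
have q1 : 1 <= ((d.+1)`!)%:R :> R by rewrite ler1n fact_gt0.
exists (2 ^+ d.+1 * (2 + ln ((d.+1)`!)%:R + ln A) + A); split.
  by rewrite ltr_wpDl // mulr_ge0 ?exprn_ge0 // !addr_ge0 ?ln_ge0.
move=> n n1; set N := 'C(d.+1 + n, d.+1).
have N0 : (0 < N)%N by rewrite bin_gt0 leq_addr.
have mN : (N.-1 < N)%N by rewrite prednK.
have An0 : 0 < A * n%:R by rewrite mulr_gt0 // ltr0n.
have Age : n%:R * \sum_i `|cons1 x i| <= A * n%:R.
  by rewrite mulrC ler_wpM2r // lerDr.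
have /= lower := ln_En_bound_ge d n1 A1.
have dE : ((d.-1)`!%:R * d.+1%:R)^-1 = d%:R / ((d.+1)`!)%:R :> R.
  case: d d1 {x A A1 A0 q1 N N0 mN An0 Age lower} => // d _.
  rewrite !factS !natrM /=; field.
  by rewrite -(natrD _ 1) -(natrD _ 2) !pnatr_eq0 -lt0n fact_gt0.
rewrite dE; apply: le_trans (_ : _ <= (ln _)%:E)%E _.
  by rewrite lee_fin; exact: lower.
have inv0 : 0 <
    (N%:R * (expR (A * n%:R) * (A * n%:R) ^+ N.-1 / (N.-1)`!%:R))^-1.
  by rewrite invr_gt0 !mulr_gt0 ?expR_gt0 ?exprn_gt0 ?invr_gt0 ?ltr0n ?fact_gt0.
have En_lower := En_ge mN An0 Age.
rewrite -lne_EFin // lee_lne //; rewrite in_itv /= leey andbT.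
  by rewrite lee_fin ltW.
by apply: le_trans En_lower; rewrite lee_fin ltW.
Qed.
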